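(* Let $ABC$ be an acute triangle with inradius $r$, and let $\gamma_a,\gamma_b,\gamma_c$ be its associated triad of circles. Let $\rho_i$ be the radius of the inner Apollonius circle of $\gamma_a,\gamma_b,\gamma_c$ (externally tangent to each of them) and let $\rho_o$ be the radius of the outer Apollonius circle of $\gamma_a,\gamma_b,\gamma_c$ (internally tangent to each of them, surrounding all three). Then $$3\rho_o=\rho_i+4r.$$
   Context: Let $\triangle ABC$ be an acute triangle in the plane. Let $\omega_a$ be the semicircle with diameter $BC$ erected inwardly (on the same side of $BC$ as $A$); $\omega_b$ and $\omega_c$ are defined similarly on $CA$ and $AB$. The circle $\gamma_a$ is the circle inside $\triangle ABC$, tangent to sides $AB$ and $AC$, and externally tangent to the semicircle $\omega_a$. Circles $\gamma_b$ (tangent to $BC$ and $BA$, externally tangent to $\omega_b$) and $\gamma_c$ (tangent to $CA$ and $CB$, externally tangent to $\omega_c$) are defined similarly. These three circles are the triad of circles associated with $\triangle ABC$. The inner Apollonius circle of $\gamma_a,\gamma_b,\gamma_c$ is the circle externally tangent to all three (the three circles lie outside it). The outer Apollonius circle is the circle that contains all three circles and is internally tangent to all three (each of the three circles lies inside it and touches it). *)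

(* Defs.v *)
From Stdlib Require Import Reals.
Open Scope R_scope.

Definition point : Type := (R * R)%type.

Definition dist (P Q : point) : R := dist_euc (fst P) (snd P) (fst Q) (snd Q).

(** [affine t X Y] is the point [X + t (Y - X)]. *)
Definition affine (t : R) (X Y : point) : point :=
  (fst X + t * (fst Y - fst X), snd X + t * (snd Y - snd X)).

Definition on_line (X Y P : point) : Prop := exists t : R, P = affine t X Y.

Definition on_segment (X Y P : point) : Prop :=
  exists t : R, 0 <= t <= 1 /\ P = affine t X Y.

Definition midpoint (X Y : point) : point := affine (1 / 2) X Y.

(** Twice the signed area of the triangle [XYZ]. *)
Definition cross (X Y Z : point) : R :=
  (fst Y - fst X) * (snd Z - snd X) - (snd Y - snd X) * (fst Z - fst X).

(** Inner product of the vectors [Y - X] and [Z - X]. *)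
Definition dot (X Y Z : point) : R :=
  (fst Y - fst X) * (fst Z - fst X) + (snd Y - snd X) * (snd Z - snd X).

(** The unoriented angle [YXZ], with vertex [X]; meaningful for
    [Y <> X] and [Z <> X]. *)
Definition angle (Y X Z : point) : R :=
  acos (dot X Y Z / (dist X Y * dist X Z)).

Definition acute_triangle (A B C : point) : Prop :=
  cross A B C <> 0 /\
  angle B A C < PI / 2 /\ angle C B A < PI / 2 /\ angle A C B < PI / 2.

(** The closed triangular region. *)
Definition in_triangle (A B C P : point) : Prop :=
  exists u v w : R,
    0 <= u /\ 0 <= v /\ 0 <= w /\ u + v + w = 1 /\
    P = (u * fst A + v * fst B + w * fst C,
         u * snd A + v * snd B + w * snd C).

(** Positivity of the radius is not built in; the predicates below that
    single out particular circles require it. *)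
Record circle : Type := Circle { center : point; radius : R }.

Definition on_circle (g : circle) (P : point) : Prop :=
  dist P (center g) = radius g.

Definition in_disc (g : circle) (P : point) : Prop :=
  dist P (center g) <= radius g.

Definition inside_triangle (A B C : point) (g : circle) : Prop :=
  forall P : point, in_disc g P -> in_triangle A B C P.

(** The line [XY] meets [g] in exactly one point, and this point belongs to
    the segment [XY]. *)
Definition tangent_to_side (g : circle) (X Y : point) : Prop :=
  exists P : point,
    on_segment X Y P /\ on_circle g P /\
    forall Q : point, on_line X Y Q -> on_circle g Q -> Q = P.

(** The circles touch at [P] and each lies outside the other: the closed
    discs have only [P] in common. *)
Definition externally_tangent_at (g h : circle) (P : point) : Prop :=
  on_circle g P /\ on_circle h P /\
  forall Q : point, in_disc g Q -> in_disc h Q -> Q = P.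

Definition externally_tangent (g h : circle) : Prop :=
  exists P : point, externally_tangent_at g h P.

(** [g] lies inside [h] and the two circles have exactly one common point. *)
Definition internally_tangent (g h : circle) : Prop :=
  (forall Q : point, in_disc g Q -> in_disc h Q) /\
  exists P : point,
    on_circle g P /\ on_circle h P /\
    forall Q : point, on_circle g Q -> on_circle h Q -> Q = P.

Definition incircle (A B C : point) (g : circle) : Prop :=
  0 < radius g /\ inside_triangle A B C g /\
  tangent_to_side g B C /\ tangent_to_side g C A /\ tangent_to_side g A B.

Definition diameter_circle (B C : point) : circle :=
  Circle (midpoint B C) (dist B C / 2).

(** The semicircle with diameter [BC] on the same side of [BC] as [A]
    (endpoints included). *)
Definition on_semicircle (A B C P : point) : Prop :=
  on_circle (diameter_circle B C) P /\ 0 <= cross B C P * cross B C A.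

(** Tangency to a semicircle is tangency to its supporting circle at a point
    of the arc. *)
Definition externally_tangent_to_semicircle (g : circle) (A B C : point)
  : Prop :=
  exists P : point,
    on_semicircle A B C P /\
    externally_tangent_at g (diameter_circle B C) P.

(** The circle of the triad that corresponds to the vertex [A]. *)
Definition triad_circle (A B C : point) (g : circle) : Prop :=
  0 < radius g /\ inside_triangle A B C g /\
  tangent_to_side g A B /\ tangent_to_side g A C /\
  externally_tangent_to_semicircle g A B C.

Definition triad (A B C : point) (ga gb gc : circle) : Prop :=
  triad_circle A B C ga /\ triad_circle B C A gb /\ triad_circle C A B gc.

Definition inner_apollonius (ga gb gc g : circle) : Prop :=
  0 < radius g /\
  externally_tangent ga g /\ externally_tangent gb g /\
  externally_tangent gc g.

Definition outer_apollonius (ga gb gc g : circle) : Prop :=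
  0 < radius g /\
  internally_tangent ga g /\ internally_tangent gb g /\
  internally_tangent gc g.

(* Main.v *)
(** Take the incenter [I] as origin and let [x, y, z] be the tangent lengths
    from [A, B, C], [p = x + y + z].  The circle of the triad at [A] has centre
    [(r / x) A] and radius [r - r^2 / x]: the ratio [r / x] is the only
    nonnegative root of the quadratic expressing tangency with the semicircle.
    For an Apollonius circle with centre [P], put [s = r + rho_i], resp.
    [s = r - rho_o]; both kinds of tangency then give the same three equations
    in [P] and [s].  They force [P = s Q] with [Q] independent of [s], and
    [u = s p / (x y + y z + z x)] satisfies [3 u^2 - 2 u - 1 = 0].  So [u = 1]
    for the inner circle and [u = -1/3] for the outer one. *)

From Stdlib Require Import Reals Lra Psatz.
Require Import Defs.
Open Scope R_scope.

(** * Distances and their squares *)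

Lemma sqr_sum_eq0 (u v : R) : u ^ 2 + v ^ 2 = 0 -> u = 0 /\ v = 0.
Proof.
  intros h; split; apply Rsqr_0_uniq; unfold Rsqr;
    pose proof (pow2_ge_0 u); pose proof (pow2_ge_0 v); nra.
Qed.

Lemma dist_sqr (P Q : point) :
  dist P Q ^ 2 = (fst P - fst Q) ^ 2 + (snd P - snd Q) ^ 2.
Proof.
  unfold dist, dist_euc, Rsqr; rewrite pow2_sqrt; [ring |].
  apply Rplus_le_le_0_compat; apply Rle_0_sqr.
Qed.

Lemma dist_ge0 (P Q : point) : 0 <= dist P Q.
Proof. apply sqrt_pos. Qed.

Lemma dist_le_sqr (P Q : point) (d : R) :
  0 <= d -> (fst P - fst Q) ^ 2 + (snd P - snd Q) ^ 2 <= d ^ 2 -> dist P Q <= d.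
Proof.
  intros hd h; rewrite <- dist_sqr in h.
  pose proof (dist_ge0 P Q); nra.
Qed.

Lemma dist_eq_sqr (P Q : point) (d : R) :
  0 <= d -> (fst P - fst Q) ^ 2 + (snd P - snd Q) ^ 2 = d ^ 2 -> dist P Q = d.
Proof.
  intros hd h; rewrite <- dist_sqr in h.
  pose proof (dist_ge0 P Q); nra.
Qed.

Lemma dist_sym (P Q : point) : dist P Q = dist Q P.
Proof.
  apply dist_eq_sqr; [apply dist_ge0 | rewrite dist_sqr; ring].
Qed.

Lemma dist_triangle (P Q S : point) : dist P S <= dist P Q + dist Q S.
Proof. apply triangle. Qed.

(** * Tangency of circles in terms of the distance of the centres *)

(** Expanding the squared distance of the centres around [P] reduces the claim to [k = 0], where [k]
    is [r * s] plus the inner product of the vectors from [P] to the centres. If [k] were positive,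
    the discs would share a second point. *)
Lemma externally_tangent_at_dist (g h : circle) (P : point) :
  0 < radius g -> 0 < radius h -> externally_tangent_at g h P ->
  dist (center g) (center h) = radius g + radius h.
Proof.
  destruct g as [[g1 g2] r], h as [[h1 h2] s], P as [p1 p2]; cbn [fst snd center radius].
  intros hr hs [hg [hh huniq]]; unfold on_circle in hg, hh; cbn [fst snd center radius] in hg, hh.
  pose proof (dist_sqr (p1, p2) (g1, g2)) as eg; rewrite hg in eg; cbn [fst snd center radius] in eg.
  pose proof (dist_sqr (p1, p2) (h1, h2)) as eh; rewrite hh in eh; cbn [fst snd center radius] in eh.
  (* The point dividing the centres in the ratio of the radii is the sum of [P]
     and the displacement below, and lies in both discs. *)
  set (v1 := (s * (g1 - p1) + r * (h1 - p1)) / (r + s)).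
  set (v2 := (s * (g2 - p2) + r * (h2 - p2)) / (r + s)).
  set (k := r * s + (g1 - p1) * (h1 - p1) + (g2 - p2) * (h2 - p2)).
  assert (hv : v1 ^ 2 + v2 ^ 2 = 2 * r * s * k / (r + s) ^ 2).
  { apply Rmult_eq_reg_r with ((r + s) ^ 2); [| nra].
    replace ((v1 ^ 2 + v2 ^ 2) * (r + s) ^ 2) with
      ((s * (g1 - p1) + r * (h1 - p1)) ^ 2 + (s * (g2 - p2) + r * (h2 - p2)) ^ 2)
      by (unfold v1, v2; field; lra).
    replace (2 * r * s * k / (r + s) ^ 2 * (r + s) ^ 2) with (2 * r * s * k)
      by (field; lra).
    unfold k; nra. }
  assert (hgv : (g1 - p1) * v1 + (g2 - p2) * v2 = r * k / (r + s)).
  { transitivity ((s * ((p1 - g1) ^ 2 + (p2 - g2) ^ 2) + r * (k - r * s)) / (r + s)).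
    - unfold v1, v2, k; field; lra.
    - replace ((p1 - g1) ^ 2 + (p2 - g2) ^ 2) with (r ^ 2) by lra. field; lra. }
  assert (hhv : (h1 - p1) * v1 + (h2 - p2) * v2 = s * k / (r + s)).
  { transitivity ((r * ((p1 - h1) ^ 2 + (p2 - h2) ^ 2) + s * (k - r * s)) / (r + s)).
    - unfold v1, v2, k; field; lra.
    - replace ((p1 - h1) ^ 2 + (p2 - h2) ^ 2) with (s ^ 2) by lra. field; lra. }
  (* By [hv], a positive multiple of this quantity is a squared length. *)
  assert (hk : 0 <= k / (r + s) ^ 2).
  { assert (0 <= 2 * r * s * (k / (r + s) ^ 2)) by
      (replace (2 * r * s * (k / (r + s) ^ 2)) with (v1 ^ 2 + v2 ^ 2) by
         (rewrite hv; field; lra); nra).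
    assert (0 < r * s) by nra. nra. }
  (* The displaced point has squared distances [r ^ 2 - 2 * r ^ 2 * k / (r + s) ^ 2] and
     [s ^ 2 - 2 * s ^ 2 * k / (r + s) ^ 2] from the centres, so [hk] puts it in both discs. *)
  assert (h0 : (p1 + v1, p2 + v2) = (p1, p2)).
  { apply huniq; unfold in_disc; cbn [fst snd center radius]; apply dist_le_sqr; cbn [fst snd center radius]; try lra.
    - replace ((p1 + v1 - g1) ^ 2 + (p2 + v2 - g2) ^ 2) with
        ((p1 - g1) ^ 2 + (p2 - g2) ^ 2
         - 2 * ((g1 - p1) * v1 + (g2 - p2) * v2) + (v1 ^ 2 + v2 ^ 2)) by ring.
      rewrite hgv, hv.
      replace (2 * r * s * k / (r + s) ^ 2) with
        (2 * (r * k / (r + s)) - 2 * r ^ 2 * (k / (r + s) ^ 2)) by (field; lra).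
      nra.
    - replace ((p1 + v1 - h1) ^ 2 + (p2 + v2 - h2) ^ 2) with
        ((p1 - h1) ^ 2 + (p2 - h2) ^ 2
         - 2 * ((h1 - p1) * v1 + (h2 - p2) * v2) + (v1 ^ 2 + v2 ^ 2)) by ring.
      rewrite hhv, hv.
      replace (2 * r * s * k / (r + s) ^ 2) with
        (2 * (s * k / (r + s)) - 2 * s ^ 2 * (k / (r + s) ^ 2)) by (field; lra).
      nra. }
  injection h0 as e1 e2.
  assert (k = 0).
  { assert (e : r * k / (r + s) = 0)
      by (rewrite <- hgv; replace v1 with 0 by lra; replace v2 with 0 by lra; ring).
    apply (f_equal (fun t => t * (r + s) / r)) in e.
    replace (r * k / (r + s) * (r + s) / r) with k in e by (field; lra).
    rewrite e; field; lra. }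
  apply dist_eq_sqr; cbn [fst snd center radius]; [lra |].
  unfold k in *; nra.
Qed.

(** The triangle inequality through the common point gives [s <= r + d]. Conversely, the point of
    the inner disc farthest from [H] is at distance [d + r] from it and still lies in the outer
    disc. *)
Lemma internally_tangent_dist (g h : circle) :
  0 < radius g -> internally_tangent g h ->
  dist (center g) (center h) = radius h - radius g.
Proof.
  destruct g as [G r], h as [H s]; cbn [fst snd center radius].
  intros hr [hsub [P [hg [hh _]]]].
  unfold on_circle in hg, hh; unfold in_disc in hsub; cbn [fst snd center radius] in *.
  pose proof (dist_triangle P G H) as ht.
  enough (dist G H + r <= s) by lra.
  destruct G as [g1 g2], H as [h1 h2].
  set (d := dist (g1, g2) (h1, h2)) in *.
  assert (hd : 0 <= d) by apply dist_ge0.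
  assert (ed : d ^ 2 = (g1 - h1) ^ 2 + (g2 - h2) ^ 2) by apply dist_sqr.
  assert (hs : 0 <= s) by (rewrite <- hh; apply dist_ge0).
  (* For concentric circles the direction of the farthest point is arbitrary; otherwise it is that
     of the vector from [H] to [G]. *)
  destruct (Req_dec d 0) as [h0 | h0].
  - assert (g1 = h1 /\ g2 = h2) as [-> ->]
      by (destruct (sqr_sum_eq0 (g1 - h1) (g2 - h2)); [rewrite <- ed, h0; ring | lra]).
    assert (hle : dist (h1 + r, h2) (h1, h2) <= s).
    { apply hsub, dist_le_sqr; cbn [fst snd center radius]; nra. }
    rewrite (dist_eq_sqr _ _ r) in hle; cbn [fst snd center radius]; nra.
  - assert (hle : dist (g1 + r / d * (g1 - h1), g2 + r / d * (g2 - h2)) (h1, h2) <= s).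
    { apply hsub, dist_le_sqr; cbn [fst snd center radius]; [lra |].
      replace ((g1 + r / d * (g1 - h1) - g1) ^ 2 + (g2 + r / d * (g2 - h2) - g2) ^ 2)
        with ((r / d) ^ 2 * ((g1 - h1) ^ 2 + (g2 - h2) ^ 2)) by ring.
      rewrite <- ed; apply Req_le; field; exact h0. }
    rewrite (dist_eq_sqr _ _ (d + r)) in hle; cbn [fst snd center radius]; [lra | lra |].
    replace ((g1 + r / d * (g1 - h1) - h1) ^ 2 + (g2 + r / d * (g2 - h2) - h2) ^ 2)
      with ((1 + r / d) ^ 2 * ((g1 - h1) ^ 2 + (g2 - h2) ^ 2)) by ring.
    rewrite <- ed; field; exact h0.
Qed.

(** * Tangency to a side and signed heights *)

(* Reflecting the tangency point in the foot of the perpendicular from the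
   centre gives another common point, so the two coincide. *)
Lemma tangent_to_side_cross (g : circle) (X Y : point) :
  0 < dist X Y -> tangent_to_side g X Y ->
  cross X Y (center g) ^ 2 = (radius g * dist X Y) ^ 2.
Proof.
  destruct g as [[c1 c2] r], X as [x1 x2], Y as [y1 y2]; cbn [fst snd center radius].
  intros hXY [P [[t [_ hP]] [hg huniq]]].
  pose proof (dist_sqr (x1, x2) (y1, y2)) as eXY; cbn [fst snd center radius] in eXY.
  unfold on_circle in hg; cbn [fst snd center radius] in hg.
  pose proof (dist_sqr P (c1, c2)) as eP; rewrite hg in eP.
  unfold cross; cbn [fst snd center radius].
  replace ((r * dist (x1, x2) (y1, y2)) ^ 2)
    with (r ^ 2 * dist (x1, x2) (y1, y2) ^ 2) by ring.
  assert (hn : 0 < dist (x1, x2) (y1, y2) ^ 2) by nra.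
  rewrite eXY, eP in *.
  subst P; unfold affine in *; cbn [fst snd center radius] in *.
  set (n := (x1 - y1) ^ 2 + (x2 - y2) ^ 2) in *.
  set (f := ((c1 - x1) * (y1 - x1) + (c2 - x2) * (y2 - x2)) / n).
  assert (hf : f * n = (c1 - x1) * (y1 - x1) + (c2 - x2) * (y2 - x2))
    by (unfold f; field; lra).
  set (Q := (x1 + (2 * f - t) * (y1 - x1), x2 + (2 * f - t) * (y2 - x2)) : point).
  assert (hQ : Q = (x1 + t * (y1 - x1), x2 + t * (y2 - x2))).
  { apply huniq.
    - exists (2 * f - t); reflexivity.
    - unfold on_circle; cbn [fst snd center radius]; rewrite <- hg.
      apply dist_eq_sqr; [apply dist_ge0 |].
      rewrite dist_sqr; unfold Q; cbn [fst snd center radius].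
      match goal with |- ?L = ?R => enough (L - R =
        4 * (f - t) * (f * n - ((c1 - x1) * (y1 - x1) + (c2 - x2) * (y2 - x2)))) by
          (rewrite hf in *; lra) end.
      unfold n; ring. }
  unfold Q in hQ; injection hQ as e1 e2.
  assert (f = t).
  { assert (k1 : (f - t) * (y1 - x1) = 0) by lra.
    assert (k2 : (f - t) * (y2 - x2) = 0) by lra.
    assert (k : (f - t) * n = 0).
    { transitivity ((f - t) * (y1 - x1) * (y1 - x1) + (f - t) * (y2 - x2) * (y2 - x2));
        [unfold n; ring | rewrite k1, k2; ring]. }
    destruct (Rmult_integral _ _ k); lra. }
  subst t.
  (* Lagrange's identity: the squares of the cross and inner products add up to the product of the
     squared lengths. *)
  match goal with |- ?L = ?R => replace L with
    (((c1 - x1) ^ 2 + (c2 - x2) ^ 2) * n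
     - ((c1 - x1) * (y1 - x1) + (c2 - x2) * (y2 - x2)) ^ 2) by (unfold n; ring) end.
  rewrite <- hf.
  match goal with |- ?L = ?R => replace R with
    (((c1 - x1) ^ 2 + (c2 - x2) ^ 2) * n
      - 2 * f * ((c1 - x1) * (y1 - x1) + (c2 - x2) * (y2 - x2)) * n
      + f ^ 2 * n ^ 2) by (unfold n; ring) end.
  rewrite <- hf; ring.
Qed.

Lemma inside_triangle_cycle (A B C : point) (g : circle) :
  inside_triangle A B C g -> inside_triangle B C A g.
Proof.
  intros h P hP; destruct (h P hP) as (u & v & w & hu & hv & hw & hs & ->).
  exists v, w, u; repeat split; try lra; f_equal; ring.
Qed.

Lemma cross_cycle (A B C : point) : cross B C A = cross A B C.
Proof. unfold cross; ring. Qed.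

(** Here [e] is the orientation sign of the triangle. The point of the disc farthest in the outward
    normal direction of [BC] lies in the triangle, so its barycentric coordinate [u] at [A] is
    nonnegative, and the difference of the two sides is [u] times the doubled area. *)
Lemma inside_triangle_cross (A B C : point) (g : circle) (e : R) :
  e * e = 1 -> 0 < e * cross A B C -> 0 < radius g -> 0 < dist B C ->
  inside_triangle A B C g ->
  radius g * dist B C <= e * cross B C (center g).
Proof.
  destruct g as [[c1 c2] r], A as [a1 a2], B as [b1 b2], C as [d1 d2]; cbn [fst snd center radius].
  intros he hS hr ha hin.
  pose proof (dist_sqr (b1, b2) (d1, d2)) as ea; cbn [fst snd center radius] in ea.
  set (a := dist (b1, b2) (d1, d2)) in *.
  assert (hd : in_disc (Circle (c1, c2) r)
     (c1 + e * r / a * (d2 - b2), c2 - e * r / a * (d1 - b1))).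
  { unfold in_disc; cbn [fst snd center radius]; apply dist_le_sqr; cbn [fst snd center radius]; [lra |].
    match goal with |- ?L <= _ => replace L with
      ((e * e) * r ^ 2 / a ^ 2 * ((b1 - d1) ^ 2 + (b2 - d2) ^ 2)) by (field; lra) end.
    rewrite <- ea, he; apply Req_le; field; lra. }
  destruct (hin _ hd) as (u & v & w & hu & hv & hw & hs & hP).
  injection hP as e1 e2.
  assert (hcr : e * cross (b1, b2) (d1, d2) (c1, c2) - r * a
    = u * (e * cross (a1, a2) (b1, b2) (d1, d2))).
  { replace (r * a) with ((e * e) * r / a * ((b1 - d1) ^ 2 + (b2 - d2) ^ 2))
      by (rewrite he, <- ea; field; lra).
    transitivity (e * ((d1 - b1) * (c2 - e * r / a * (d1 - b1) - b2)
                     - (d2 - b2) * (c1 + e * r / a * (d2 - b2) - b1))).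
    - unfold cross; cbn [fst snd center radius]; field; lra.
    - rewrite e1, e2; unfold cross; cbn [fst snd center radius].
      replace u with (1 - v - w) by lra; ring. }
  nra.
Qed.

(** Tangency determines the square of the signed height, and containment in the triangle determines
    its sign. *)
Lemma inside_tangent_cross (A B C : point) (g : circle) (e : R) :
  e * e = 1 -> 0 < e * cross A B C -> 0 < radius g -> 0 < dist B C ->
  inside_triangle A B C g -> tangent_to_side g B C ->
  e * cross B C (center g) = radius g * dist B C.
Proof.
  intros he hS hr ha hin ht.
  pose proof (inside_triangle_cross A B C g e he hS hr ha hin) as h1.
  pose proof (tangent_to_side_cross g B C ha ht) as h2.
  assert (0 < radius g * dist B C) by nra.
  assert ((e * cross B C (center g)) ^ 2 = (radius g * dist B C) ^ 2)
    by (rewrite <- h2; transitivity (e * e * cross B C (center g) ^ 2);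
        [ring | rewrite he; ring]).
  nra.
Qed.

Lemma dist_pos_of_cross (A B C : point) : cross A B C <> 0 -> 0 < dist A B.
Proof.
  intros h; pose proof (dist_ge0 A B) as hd.
  destruct hd as [hd | hd]; [exact hd |].
  pose proof (dist_sqr A B) as e; rewrite <- hd in e.
  destruct (sqr_sum_eq0 (fst A - fst B) (snd A - snd B)) as [e1 e2];
    [rewrite <- e; ring |].
  exfalso; apply h; unfold cross.
  replace (fst B) with (fst A) by lra; replace (snd B) with (snd A) by lra; ring.
Qed.

Lemma tangent_to_side_sym (g : circle) (X Y : point) :
  tangent_to_side g X Y -> tangent_to_side g Y X.
Proof.
  assert (haff : forall t, affine t Y X = affine (1 - t) X Y)
    by (intros t; unfold affine; f_equal; ring).
  intros (P & (t & ht & hP) & hg & hu); exists P; repeat split; auto.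
  - exists (1 - t); split; [lra |].
    rewrite haff, hP; f_equal; ring.
  - intros Q (s & hs) hQ; apply hu; auto.
    exists (1 - s); rewrite hs; apply haff.
Qed.

(** * Metric data of the incenter *)

(** [I] is the incenter, [r] the inradius and [x, y, z] the tangent lengths. *)
Definition incenter_data (A B C I : point) (r x y z : R) : Prop :=
  0 < r /\ 0 < x /\ 0 < y /\ 0 < z /\
  r ^ 2 * (x + y + z) = x * y * z /\
  dist A B = x + y /\ dist B C = y + z /\ dist C A = z + x /\
  dot I A A = r ^ 2 + x ^ 2 /\ dot I B B = r ^ 2 + y ^ 2 /\
  dot I C C = r ^ 2 + z ^ 2 /\
  dot I A B = r ^ 2 - x * y /\ dot I B C = r ^ 2 - y * z /\
  dot I C A = r ^ 2 - z * x.

Lemma incenter_data_cycle (A B C I : point) (r x y z : R) :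
  incenter_data A B C I r x y z -> incenter_data B C A I r y z x.
Proof.
  unfold incenter_data; intros H; decompose [and] H; repeat split; lra.
Qed.

(** Cramer's rule: a vector parallel to the two independent sides [AB] and [AC] is zero. It serves
    to locate a center from its heights over two sides. *)
Lemma vector_eq0 (A B C : point) (v1 v2 : R) :
  cross A B C <> 0 ->
  (fst B - fst A) * v2 - (snd B - snd A) * v1 = 0 ->
  (fst C - fst A) * v2 - (snd C - snd A) * v1 = 0 ->
  v1 = 0 /\ v2 = 0.
Proof.
  intros h h1 h2.
  assert (e1 : cross A B C * v1 = 0).
  { transitivity ((fst C - fst A) * ((fst B - fst A) * v2 - (snd B - snd A) * v1)
      - (fst B - fst A) * ((fst C - fst A) * v2 - (snd C - snd A) * v1)).
    - unfold cross; ring.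
    - rewrite h1, h2; ring. }
  assert (e2 : cross A B C * v2 = 0).
  { transitivity ((snd C - snd A) * ((fst B - fst A) * v2 - (snd B - snd A) * v1)
      - (snd B - snd A) * ((fst C - fst A) * v2 - (snd C - snd A) * v1)).
    - unfold cross; ring.
    - rewrite h1, h2; ring. }
  split; [destruct (Rmult_integral _ _ e1) | destruct (Rmult_integral _ _ e2)];
    tauto.
Qed.

Lemma dot_polarization (X Y Z : point) :
  2 * dot X Y Z = dist X Y ^ 2 + dist X Z ^ 2 - dist Y Z ^ 2.
Proof. rewrite !dist_sqr; unfold dot; ring. Qed.

(** The last two hypotheses say that [I] has barycentric coordinates [a : b : c]. Solving for the
    vector from [A] to [I], squaring, and applying the law of cosines gives the formula. *)
Lemma dot_self_incenter (A B C I : point) (a b c p : R) :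
  0 < p -> 2 * p = a + b + c ->
  dist B C = a -> dist C A = b -> dist A B = c ->
  a * (fst A - fst I) + b * (fst B - fst I) + c * (fst C - fst I) = 0 ->
  a * (snd A - snd I) + b * (snd B - snd I) + c * (snd C - snd I) = 0 ->
  dot I A A = b * c * (p - a) / p.
Proof.
  intros hp h2p ha hb hc n1 n2.
  assert (e1 : 2 * p * (fst I - fst A) = b * (fst B - fst A) + c * (fst C - fst A))
    by (rewrite h2p; lra).
  assert (e2 : 2 * p * (snd I - snd A) = b * (snd B - snd A) + c * (snd C - snd A))
    by (rewrite h2p; lra).
  pose proof (dot_polarization A B C) as hd.
  pose proof (dist_sqr A B) as sc; pose proof (dist_sqr C A) as sb.
  rewrite (dist_sym A C), ha, hb, hc in *.
  assert (E : 4 * p ^ 2 * dot I A A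
    = b ^ 2 * c ^ 2 + c ^ 2 * b ^ 2 + 2 * b * c * dot A B C).
  { transitivity ((2 * p * (fst I - fst A)) ^ 2 + (2 * p * (snd I - snd A)) ^ 2).
    - unfold dot; ring.
    - rewrite e1, e2.
      transitivity (b ^ 2 * ((fst A - fst B) ^ 2 + (snd A - snd B) ^ 2)
        + c ^ 2 * ((fst C - fst A) ^ 2 + (snd C - snd A) ^ 2)
        + 2 * b * c * dot A B C); [unfold dot; ring |].
      rewrite <- sc, <- sb; ring. }
  apply Rmult_eq_reg_l with (4 * p ^ 2); [| nra].
  rewrite E.
  replace (4 * p ^ 2 * (b * c * (p - a) / p))
    with (b * c * (2 * p) * (2 * p - 2 * a)) by (field; lra).
  rewrite h2p.
  replace (2 * b * c * dot A B C) with (b * c * (2 * dot A B C)) by ring.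
  rewrite hd; ring.
Qed.

(** Equal heights [r] over the three sides give [I] the barycentric coordinates [a : b : c]. The
    tangent lengths are [p - a], [p - b], [p - c] with [p] the semiperimeter, and mixed inner
    products follow by polarization. *)
Lemma incircle_data (A B C : point) (g : circle) (e : R) :
  e * e = 1 -> 0 < e * cross A B C -> incircle A B C g ->
  exists x y z, incenter_data A B C (center g) (radius g) x y z.
Proof.
  intros he hS (hr & hin & tA & tB & tC).
  assert (hne : cross A B C <> 0) by (intros h0; rewrite h0 in hS; lra).
  assert (pc : 0 < dist A B) by (apply dist_pos_of_cross with C; exact hne).
  assert (pa : 0 < dist B C)
    by (apply dist_pos_of_cross with A; rewrite cross_cycle; exact hne).
  assert (pb : 0 < dist C A)
    by (apply dist_pos_of_cross with B; rewrite 2!cross_cycle; exact hne).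
  pose proof (inside_triangle_cycle _ _ _ _ hin) as hin'.
  pose proof (inside_triangle_cycle _ _ _ _ hin') as hin''.
  pose proof (inside_tangent_cross A B C g e he hS hr pa hin tA) as cA.
  rewrite <- cross_cycle in hS.
  pose proof (inside_tangent_cross B C A g e he hS hr pb hin' tB) as cB.
  rewrite <- cross_cycle in hS.
  pose proof (inside_tangent_cross C A B g e he hS hr pc hin'' tC) as cC.
  rewrite 2!cross_cycle in hS.
  destruct g as [I r]; cbn [fst snd center radius] in *; clear tA tB tC hin hin' hin''.
  pose proof (dot_polarization A B C) as hpol.
  rewrite (dist_sym A C) in hpol.
  remember (dist B C) as a eqn:Ea; remember (dist C A) as b eqn:Eb;
  remember (dist A B) as c eqn:Ec.
  set (p := (a + b + c) / 2).
  assert (hp : 0 < p) by (unfold p; lra).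
  assert (h2p : 2 * p = a + b + c) by (unfold p; field).
  (* The triangle is cut into three triangles with apex [I]. *)
  assert (hsum : e * cross A B C = r * (2 * p)).
  { transitivity (e * cross B C I + e * cross C A I + e * cross A B I);
      [unfold cross; ring | rewrite cA, cB, cC, h2p; ring]. }
  assert (hv : 2 * p * (fst I - fst A) - (b * (fst B - fst A) + c * (fst C - fst A)) = 0
    /\ 2 * p * (snd I - snd A) - (b * (snd B - snd A) + c * (snd C - snd A)) = 0).
  { apply (vector_eq0 A B C); [exact hne | |];
    (apply Rmult_eq_reg_l with e; [| nra]); rewrite Rmult_0_r.
    - transitivity (2 * p * (e * cross A B I) - c * (e * cross A B C));
        [unfold cross; ring | rewrite cC, hsum; ring].
    - transitivity (- (2 * p * (e * cross C A I)) + b * (e * cross A B C));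
        [unfold cross; ring | rewrite cB, hsum; ring]. }
  rewrite h2p in hv; destruct hv as [hv1 hv2].
  assert (dA : dot I A A = b * c * (p - a) / p)
    by (apply (dot_self_incenter A B C); auto; lra).
  assert (dB : dot I B B = c * a * (p - b) / p)
    by (apply (dot_self_incenter B C A); auto; lra).
  assert (dC : dot I C C = a * b * (p - c) / p)
    by (apply (dot_self_incenter C A B); auto; lra).
  (* Heron's formula, with the area written as [r * p]. *)
  assert (hr2 : r ^ 2 * p = (p - a) * (p - b) * (p - c)).
  { assert (E : (e * cross A B C) ^ 2 = c ^ 2 * b ^ 2 - dot A B C ^ 2).
    { transitivity ((e * e) * cross A B C ^ 2); [ring | rewrite he].
      subst b c; rewrite !dist_sqr; unfold dot, cross; ring. }
    rewrite hsum in E.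
    apply Rmult_eq_reg_l with (4 * p); [| lra].
    replace (4 * p * (r ^ 2 * p)) with ((r * (2 * p)) ^ 2) by ring.
    rewrite E; replace (dot A B C) with ((c ^ 2 + b ^ 2 - a ^ 2) / 2) by lra.
    unfold p; field. }
  (* The triangle inequalities are strict because the product in [hr2] is nonzero. *)
  assert (tri1 : a < b + c /\ b < c + a /\ c < a + b).
  { pose proof (dist_triangle B A C) as t1; pose proof (dist_triangle C B A) as t2;
    pose proof (dist_triangle A C B) as t3.
    rewrite (dist_sym B A), (dist_sym A C), <- Ea, <- Eb, <- Ec in t1.
    rewrite (dist_sym C B), (dist_sym B A), <- Ea, <- Eb, <- Ec in t2.
    rewrite (dist_sym C B), (dist_sym A C), <- Ea, <- Eb, <- Ec in t3.
    assert (0 < r ^ 2 * p) by (apply Rmult_lt_0_compat; [nra | lra]).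
    assert (p - a <> 0 /\ p - b <> 0 /\ p - c <> 0) as (n1 & n2 & n3)
      by (repeat split; intros h0; rewrite h0 in hr2; lra).
    lra. }
  assert (dAB := dot_polarization I A B).
  assert (dBC := dot_polarization I B C).
  assert (dCA := dot_polarization I C A).
  assert (hself : forall X, dist I X ^ 2 = dot I X X)
    by (intros X; rewrite dist_sqr; unfold dot; ring).
  rewrite !hself, <- Ec in dAB; rewrite !hself, <- Ea in dBC;
  rewrite !hself, <- Eb in dCA.
  assert (er : r ^ 2 = (p - a) * (p - b) * (p - c) / p)
    by (rewrite <- hr2; field; lra).
  assert (sA : dot I A A = r ^ 2 + (p - a) ^ 2)
    by (rewrite dA, er; unfold p; field; lra).
  assert (sB : dot I B B = r ^ 2 + (p - b) ^ 2)
    by (rewrite dB, er; unfold p; field; lra).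
  assert (sC : dot I C C = r ^ 2 + (p - c) ^ 2)
    by (rewrite dC, er; unfold p; field; lra).
  clear hself hpol dA dB dC er.
  exists (p - a), (p - b), (p - c); unfold incenter_data.
  rewrite <- Ea, <- Eb, <- Ec.
  rewrite sA, sB in dAB; rewrite sB, sC in dBC; rewrite sC, sA in dCA.
  repeat split; try lra.
  - replace (p - a + (p - b) + (p - c)) with p by (unfold p; field). exact hr2.
  - replace (c ^ 2) with (((p - a) + (p - b)) ^ 2) in dAB by (unfold p; field). lra.
  - replace (a ^ 2) with (((p - b) + (p - c)) ^ 2) in dBC by (unfold p; field). lra.
  - replace (b ^ 2) with (((p - c) + (p - a)) ^ 2) in dCA by (unfold p; field). lra.
Qed.

(** * Centres and radii of the triad *)

(** Tangency to both sides through [A] makes the circle the image of the incircle under the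
    homothety at [A] of ratio [q / r]. Thus its centre is [I + s (A - I)] with [s = 1 - q / r], and
    tangency to the semicircle fixes [s]. *)
Lemma triad_circle_center (A B C : point) (inc g : circle) (e x y z : R) :
  e * e = 1 -> 0 < e * cross A B C ->
  incircle A B C inc ->
  incenter_data A B C (center inc) (radius inc) x y z ->
  triad_circle A B C g ->
  radius g = radius inc - radius inc ^ 2 / x /\
  fst (center g) - fst (center inc)
    = radius inc / x * (fst A - fst (center inc)) /\
  snd (center g) - snd (center inc)
    = radius inc / x * (snd A - snd (center inc)).
Proof.
  intros he hS (hr & hin0 & tA0 & tB0 & tC0) hdata (hg & hin & tC & tB & (P & _ & hP)).
  apply tangent_to_side_sym in tB.
  assert (hne : cross A B C <> 0) by (intros h0; rewrite h0 in hS; lra).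
  assert (pc : 0 < dist A B) by (apply dist_pos_of_cross with C; exact hne).
  assert (pa : 0 < dist B C)
    by (apply dist_pos_of_cross with A; rewrite cross_cycle; exact hne).
  assert (pb : 0 < dist C A)
    by (apply dist_pos_of_cross with B; rewrite 2!cross_cycle; exact hne).
  pose proof (inside_triangle_cycle _ _ _ _ hin0) as hin0'.
  pose proof (inside_triangle_cycle _ _ _ _ hin0') as hin0''.
  pose proof (inside_triangle_cycle _ _ _ _ hin) as hin'.
  pose proof (inside_triangle_cycle _ _ _ _ hin') as hin''.
  pose proof (inside_tangent_cross A B C inc e he hS hr pa hin0 tA0) as iA.
  pose proof (inside_triangle_cross A B C g e he hS hg pa hin) as cA.
  rewrite <- cross_cycle in hS.
  pose proof (inside_tangent_cross B C A inc e he hS hr pb hin0' tB0) as iB.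
  pose proof (inside_tangent_cross B C A g e he hS hg pb hin' tB) as cB.
  rewrite <- cross_cycle in hS.
  pose proof (inside_tangent_cross C A B inc e he hS hr pc hin0'' tC0) as iC.
  pose proof (inside_tangent_cross C A B g e he hS hg pc hin'' tC) as cC.
  rewrite 2!cross_cycle in hS.
  clear hin0 hin0' hin0'' hin hin' hin'' tA0 tB0 tC0 tB tC.
  apply externally_tangent_at_dist in hP; [| exact hg | simpl; lra].
  unfold diameter_circle in hP; destruct inc as [I r], g as [O q]; cbn [fst snd center radius] in *.
  assert (hv : r * (fst O - fst A) - q * (fst I - fst A) = 0
    /\ r * (snd O - snd A) - q * (snd I - snd A) = 0).
  { apply (vector_eq0 A B C); [exact hne | |];
    (apply Rmult_eq_reg_l with e; [| nra]); rewrite Rmult_0_r.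
    - transitivity (r * (e * cross A B O) - q * (e * cross A B I));
        [unfold cross; ring | rewrite cC, iC; ring].
    - transitivity (- (r * (e * cross C A O)) + q * (e * cross C A I));
        [unfold cross; ring | rewrite cB, iB; ring]. }
  destruct hv as [hv1 hv2].
  (* The signed areas at [O] and at [I] have the same sum. At [O] they are at least [q] times the
     sides, at [I] exactly [r] times the sides. *)
  assert (hle : q <= r).
  { assert (E : e * cross A B O + e * cross B C O + e * cross C A O
      = e * cross A B I + e * cross B C I + e * cross C A I)
      by (unfold cross; ring).
    rewrite iA, iB, iC, cB, cC in E. nra. }
  set (s := 1 - q / r).
  assert (hs : 0 <= s).
  { unfold s; enough (q / r <= 1) by lra.
    apply Rmult_le_reg_r with r; [lra |].
    replace (q / r * r) with q by (field; lra). lra. }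
  assert (hq : q = r * (1 - s)) by (unfold s; field; lra).
  assert (o1 : fst O - fst I = s * (fst A - fst I)).
  { apply Rmult_eq_reg_l with r; [| lra].
    transitivity (r * (fst O - fst A) + r * (fst A - fst I)); [ring |].
    replace (r * (fst O - fst A)) with (q * (fst I - fst A)) by lra.
    rewrite hq; ring. }
  assert (o2 : snd O - snd I = s * (snd A - snd I)).
  { apply Rmult_eq_reg_l with r; [| lra].
    transitivity (r * (snd O - snd A) + r * (snd A - snd I)); [ring |].
    replace (r * (snd O - snd A)) with (q * (snd I - snd A)) by lra.
    rewrite hq; ring. }
  destruct hdata as (_ & hx & hy & hz & hrel & _ & ha & _
    & dA & dB & dC & dAB & dBC & dCA).
  (* The squared distance from [O] to the midpoint of [BC], expanded around [I]. *)
  assert (E : s ^ 2 * dot I A A - s * (dot I A B + dot I C A)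
    + (dot I B B + dot I C C + 2 * dot I B C) / 4 = (q + (y + z) / 2) ^ 2).
  { rewrite <- ha, <- hP, dist_sqr; unfold midpoint, affine; cbn [fst snd center radius].
    replace (fst O) with (fst I + s * (fst A - fst I)) by lra.
    replace (snd O) with (snd I + s * (snd A - snd I)) by lra.
    unfold dot; field. }
  rewrite dA, dB, dC, dAB, dBC, dCA, hq in E.
  (* The second factor is positive for [s >= 0], which leaves [s = r / x]. *)
  assert (F : (s * x - r) * (s * x + r + (y + z) + (y + z) * r / x) = 0).
  { transitivity (s ^ 2 * x ^ 2 + s * (y + z) * (x + r) - r * (y + z)
      - r ^ 2 * (x + y + z) / x); [field; lra |].
    rewrite hrel.
    replace (x * y * z / x) with (y * z) by (field; lra).
    lra. }
  assert (hpos : 0 < s * x + r + (y + z) + (y + z) * r / x).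
  { assert (0 <= s * x) by nra.
    assert (0 < (y + z) * r / x) by (apply Rdiv_lt_0_compat; nra). lra. }
  assert (hsx : s = r / x).
  { apply Rmult_eq_reg_r with x; [| lra].
    replace (r / x * x) with r by (field; lra).
    destruct (Rmult_integral _ _ F); lra. }
  rewrite <- hsx; repeat split; auto.
  rewrite hq, hsx; field; lra.
Qed.

(** * Circles tangent to the whole triad *)

(** The distance of the centres is [s - r ^ 2 / x] for external and its negative for internal
    tangency, so squaring treats both at once. The terms [r ^ 4 / x ^ 2] cancel on expansion. *)
Lemma tangent_circle_equation (A I O P : point) (r x s : R) :
  0 < r -> 0 < x -> dot I A A = r ^ 2 + x ^ 2 ->
  fst O - fst I = r / x * (fst A - fst I) ->
  snd O - snd I = r / x * (snd A - snd I) ->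
  dist O P ^ 2 = (s - r ^ 2 / x) ^ 2 ->
  dot I P A = s * r + (dot I P P - s ^ 2 + r ^ 2) * x / (2 * r).
Proof.
  intros hr hx dA o1 o2 h.
  rewrite dist_sqr in h.
  assert (E : dot I P P - 2 * (r / x) * dot I P A + (r / x) ^ 2 * dot I A A
    = (s - r ^ 2 / x) ^ 2).
  { rewrite <- h.
    replace (fst O) with (fst I + r / x * (fst A - fst I)) by lra.
    replace (snd O) with (snd I + r / x * (snd A - snd I)) by lra.
    unfold dot; field; lra. }
  rewrite dA in E.
  apply Rmult_eq_reg_l with (2 * (r / x)).
  - transitivity (dot I P P + (r / x) ^ 2 * (r ^ 2 + x ^ 2) - (s - r ^ 2 / x) ^ 2);
      [lra | field; lra].
  - assert (0 < r / x) by (apply Rdiv_lt_0_compat; lra). lra.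
Qed.

(** The linear relation among the vertices eliminates [P] from the three equations and yields [K],
    hence the inner products of [P] with [A] and [B]. These determine [dot I P P], and the
    definition of [K] becomes the quadratic. *)
Lemma tangent_to_triad_quadratic (A B C I P : point) (r x y z s : R) :
  incenter_data A B C I r x y z ->
  (let K := dot I P P - s ^ 2 + r ^ 2 in
   dot I P A = s * r + K * x / (2 * r) /\
   dot I P B = s * r + K * y / (2 * r) /\
   dot I P C = s * r + K * z / (2 * r)) ->
  let u := s * (x + y + z) / (x * y + y * z + z * x) in
  (u - 1) * (3 * u + 1) = 0.
Proof.
  intros (hr & hx & hy & hz & hrel & _ & _ & _ & dA & dB & dC & dAB & dBC & dCA) h.
  cbv zeta in *; destruct h as (pA & pB & pC).
  set (K := dot I P P - s ^ 2 + r ^ 2) in *.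
  set (p := x + y + z) in *; set (m := x * y + y * z + z * x).
  assert (hp : 0 < p) by (unfold p; lra).
  assert (hm : 0 < m) by (unfold m; nra).
  assert (hxyz : 0 < x * y * z) by (repeat apply Rmult_lt_0_compat; assumption).
  (* [a A + b B + c C] vanishes when the incenter is the origin. *)
  assert (hnull : forall n1 n2 : R,
    n1 = (y + z) * (fst A - fst I) + (z + x) * (fst B - fst I)
         + (x + y) * (fst C - fst I) ->
    n2 = (y + z) * (snd A - snd I) + (z + x) * (snd B - snd I)
         + (x + y) * (snd C - snd I) -> n1 = 0 /\ n2 = 0).
  { intros n1 n2 e1 e2.
    (* The squared length of the vector is [4 * p * (r ^ 2 * p - x * y * z)], which is zero by
       [hrel]. *)
    apply sqr_sum_eq0.
    transitivity ((y + z) ^ 2 * dot I A A + (z + x) ^ 2 * dot I B B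
        + (x + y) ^ 2 * dot I C C + 2 * (y + z) * (z + x) * dot I A B
        + 2 * (z + x) * (x + y) * dot I B C + 2 * (x + y) * (y + z) * dot I C A).
      - rewrite e1, e2; unfold dot; ring.
      - rewrite dA, dB, dC, dAB, dBC, dCA.
        transitivity (4 * p * (r ^ 2 * p - x * y * z));
          [unfold p; ring | rewrite hrel; ring]. }
  destruct (hnull _ _ eq_refl eq_refl) as [n1 n2]; clear hnull.
  assert (hsum : (y + z) * dot I P A + (z + x) * dot I P B + (x + y) * dot I P C = 0).
  { transitivity ((fst P - fst I) * ((y + z) * (fst A - fst I)
        + (z + x) * (fst B - fst I) + (x + y) * (fst C - fst I))
      + (snd P - snd I) * ((y + z) * (snd A - snd I)
        + (z + x) * (snd B - snd I) + (x + y) * (snd C - snd I))).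
    - unfold dot; ring.
    - rewrite n1, n2; ring. }
  (* The weights sum to [2 * p], and weighted by [x, y, z] to [2 * m], so [hsum] reads
     [2 * p * s * r + K * m / r = 0]. *)
  assert (hK : K = - (2 * s * r ^ 2 * p / m)).
  { rewrite pA, pB, pC in hsum.
    apply Rmult_eq_reg_r with (m / r); [| assert (0 < m / r) by
      (apply Rdiv_lt_0_compat; lra); lra].
    replace (- (2 * s * r ^ 2 * p / m) * (m / r)) with (- (2 * s * r * p))
      by (field; lra).
    enough (K * (m / r) + 2 * s * r * p = 0) by lra.
    rewrite <- hsum; unfold m, p; field; lra. }
  assert (qA : dot I P A = s * r * (y * z - x ^ 2) / m)
    by (rewrite pA, hK; unfold p, m in *; field; lra).
  assert (qB : dot I P B = s * r * (z * x - y ^ 2) / m)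
    by (rewrite pB, hK; unfold p, m in *; field; lra).
  (* The Gram determinant of three plane vectors vanishes. *)
  assert (G : dot I P P * (dot I A A * dot I B B - dot I A B ^ 2)
    = dot I P A ^ 2 * dot I B B - 2 * dot I P A * dot I P B * dot I A B
      + dot I P B ^ 2 * dot I A A) by (unfold dot; ring).
  (* This is the coefficient of [dot I P P] in [G]: the square of twice the area of [IAB]. *)
  assert (hxy : 0 < r ^ 2 * (x + y) ^ 2)
    by (apply Rmult_lt_0_compat; apply pow_lt; lra).
  assert (hQ : dot I P P = s ^ 2 * (1 - 3 * x * y * z * p / m ^ 2)).
  { apply Rmult_eq_reg_r with (r ^ 2 * (x + y) ^ 2); [| lra].
    replace (dot I P P * (r ^ 2 * (x + y) ^ 2)) with
      (dot I P P * (dot I A A * dot I B B - dot I A B ^ 2))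
      by (rewrite dA, dB, dAB; ring).
    rewrite G, qA, qB, dA, dB, dAB.
    replace (r ^ 2) with (x * y * z / p) by (rewrite <- hrel; field; lra).
    transitivity (s ^ 2 * r ^ 2 / m ^ 2 *
      ((y * z - x ^ 2) ^ 2 * (x * y * z / p + y ^ 2)
       - 2 * (y * z - x ^ 2) * (z * x - y ^ 2) * (x * y * z / p - x * y)
       + (z * x - y ^ 2) ^ 2 * (x * y * z / p + x ^ 2))); [field; lra |].
    replace (r ^ 2) with (x * y * z / p) by (rewrite <- hrel; field; lra).
    unfold p, m in *; field; lra. }
  apply Rmult_eq_reg_l with (r ^ 2); [| apply pow_nonzero; lra].
  transitivity (K - (dot I P P - s ^ 2 + r ^ 2)); [| unfold K; ring].
  rewrite hK, hQ.
  replace (3 * x * y * z * p) with (3 * (r ^ 2 * p) * p) by (rewrite hrel; ring).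
  field; lra.
Qed.

(** * The relation between the three radii *)

Theorem corollary6p2 (A B C : point) (inc ga gb gc gi go : circle)
  (hABC : acute_triangle A B C)
  (hinc : incircle A B C inc)
  (htriad : triad A B C ga gb gc)
  (hi : inner_apollonius ga gb gc gi)
  (ho : outer_apollonius ga gb gc go) :
  3 * radius go = radius gi + 4 * radius inc.
Proof.
  destruct hABC as [hne _].
  assert (exists e, e * e = 1 /\ 0 < e * cross A B C) as (e & he & hS).
  { destruct (Rdichotomy _ _ hne); [exists (-1) | exists 1]; split; lra. }
  destruct (incircle_data A B C inc e he hS hinc) as (x & y & z & hdata).
  destruct htriad as (tA & tB & tC).
  assert (hincB : incircle B C A inc).
  { destruct hinc as (h1 & h2 & h3 & h4 & h5); split; auto; split; auto.
    apply inside_triangle_cycle; exact h2. }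
  assert (hincC : incircle C A B inc).
  { destruct hincB as (h1 & h2 & h3 & h4 & h5); split; auto; split; auto.
    apply inside_triangle_cycle; exact h2. }
  pose proof (incenter_data_cycle _ _ _ _ _ _ _ _ hdata) as hdataB.
  pose proof (incenter_data_cycle _ _ _ _ _ _ _ _ hdataB) as hdataC.
  destruct (triad_circle_center A B C inc ga e x y z he hS hinc hdata tA)
    as (ra & a1 & a2).
  rewrite <- cross_cycle in hS.
  destruct (triad_circle_center B C A inc gb e y z x he hS hincB hdataB tB)
    as (rb & b1 & b2).
  rewrite <- cross_cycle in hS.
  destruct (triad_circle_center C A B inc gc e z x y he hS hincC hdataC tC)
    as (rc & c1 & c2).
  destruct tA as (pa & _), tB as (pb & _), tC as (pc & _).
  destruct hi as (hri & (Pa & ia) & (Pb & ib) & (Pc & ic)).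
  apply externally_tangent_at_dist in ia; auto.
  apply externally_tangent_at_dist in ib; auto.
  apply externally_tangent_at_dist in ic; auto.
  destruct ho as (hro & oa & ob & oc).
  apply internally_tangent_dist in oa; auto.
  apply internally_tangent_dist in ob; auto.
  apply internally_tangent_dist in oc; auto.
  pose proof hdata as (hr & hx & hy & hz & hrel & _ & _ & _ & dA & dB & dC & _).
  set (r := radius inc) in *.
  assert (qi := tangent_to_triad_quadratic A B C (center inc) (center gi) r x y z
    (r + radius gi) hdata).
  assert (qo := tangent_to_triad_quadratic A B C (center inc) (center go) r x y z
    (r - radius go) hdata).
  cbv zeta in qi, qo.
  assert (Fi := qi (conj
    (tangent_circle_equation A _ (center ga) _ r x (r + radius gi) hr hx dA a1 a2
      ltac:(rewrite ia, ra; ring)) (conj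
    (tangent_circle_equation B _ (center gb) _ r y (r + radius gi) hr hy dB b1 b2
      ltac:(rewrite ib, rb; ring))
    (tangent_circle_equation C _ (center gc) _ r z (r + radius gi) hr hz dC c1 c2
      ltac:(rewrite ic, rc; ring))))).
  assert (Fo := qo (conj
    (tangent_circle_equation A _ (center ga) _ r x (r - radius go) hr hx dA a1 a2
      ltac:(rewrite oa, ra; ring)) (conj
    (tangent_circle_equation B _ (center gb) _ r y (r - radius go) hr hy dB b1 b2
      ltac:(rewrite ob, rb; ring))
    (tangent_circle_equation C _ (center gc) _ r z (r - radius go) hr hz dC c1 c2
      ltac:(rewrite oc, rc; ring))))).
  clear qi qo.
  set (p := x + y + z) in *; set (m := x * y + y * z + z * x) in *.
  assert (hp : 0 < p) by (unfold p; lra).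
  assert (hm : 0 < m) by (unfold m; nra).
  set (ui := (r + radius gi) * p / m) in *.
  set (uo := (r - radius go) * p / m) in *.
  assert (ei : ui * m = (r + radius gi) * p) by (unfold ui; field; lra).
  assert (eo : uo * m = (r - radius go) * p) by (unfold uo; field; lra).
  assert (hui : ui = 1).
  { assert (0 < ui) by (unfold ui; apply Rdiv_lt_0_compat; nra).
    destruct (Rmult_integral _ _ Fi); lra. }
  (* The square of [r * p] is [x * y * z * p], while [m ^ 2] contains twice this product besides
     positive squares. *)
  assert (hrp : r * p < m).
  { assert ((r * p) ^ 2 = x * y * z * p) by (rewrite <- hrel; ring).
    assert (0 < r * p) by nra.
    assert (0 < x * y * z) by (repeat apply Rmult_lt_0_compat; assumption).
    assert (x * y * z * p < m ^ 2).
    { assert (0 < x * y) by nra. assert (0 < y * z) by nra.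
      assert (0 < z * x) by nra.
      unfold m, p; nra. }
    nra. }
  (* The root [1] would give [m = (r - radius go) * p < r * p], against [hrp]. *)
  assert (huo : uo = - 1 / 3).
  { destruct (Rmult_integral _ _ Fo); [exfalso | lra].
    assert (uo = 1) as e1 by lra. rewrite e1 in eo. nra. }
  rewrite hui in ei; rewrite huo in eo.
  (* Adding [ei] and three times [eo] eliminates [m]. *)
  apply Rmult_eq_reg_r with p; lra.
Qed.
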